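(* Let $q_0,\dots,q_{m-1}\in\mathbb{H}$ with $q_0\ne0$, let $p_l(z)=z^m+\sum_{j=0}^{m-1}q_jz^j$ and $p_r(z)=z^m+\sum_{j=0}^{m-1}z^jq_j$, let $t\ge2$ be an integer and let $\gamma\in[0,1]$. For a matrix $M\in M_m(\mathbb{H})$ put $$N(M):=\max_{1\le i\le m}\left[\left(r_i'(M^t)\right)^{\gamma/t}\left(c_i'(M^t)\right)^{(1-\gamma)/t}\right].$$ Then every zero $\tilde z\in\mathbb{H}$ of $p_l(z)$ satisfies $$N(C_{q_l})^{-1}\le|\tilde z|\le N(C_{p_l})\qquad\text{and}\qquad N(C_{\tilde q_r})^{-1}\le|\tilde z|\le N(C_{\tilde p_r}),$$ and every zero $\tilde z\in\mathbb{H}$ of $p_r(z)$ satisfies $$N(C_{q_r})^{-1}\le|\tilde z|\le N(C_{p_r})\qquad\text{and}\qquad N(C_{\tilde q_l})^{-1}\le|\tilde z|\le N(C_{\tilde p_l}).$$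
   Context: $\mathbb{H}$ is the skew field of real quaternions with its usual modulus $|\cdot|$ and conjugation $q\mapsto\overline q$. For $A=(a_{ij})\in M_m(\mathbb{H})$, $r_i'(A):=\sum_{j=1}^m|a_{ij}|$ and $c_i'(A):=\sum_{j=1}^m|a_{ji}|$. Companion matrices: for a monic polynomial with left coefficients, $z^m+\sum_{j=0}^{m-1}b_jz^j$, the companion matrix is the $m\times m$ matrix with ones in positions $(i,i+1)$, $1\le i\le m-1$, last row $(-b_0,\dots,-b_{m-1})$, and zeros elsewhere; for a monic polynomial with right coefficients, $z^m+\sum_{j=0}^{m-1}z^jb_j$, the companion matrix is the transpose of that matrix (without conjugation). $C_f$ denotes the companion matrix of $f$; a subscript $l$ marks a polynomial with left coefficients and a subscript $r$ one with right coefficients. The reversal polynomials are $q_l(z):=z^m+q_0^{-1}q_1z^{m-1}+\dots+q_0^{-1}q_{m-1}z+q_0^{-1}$ and $q_r(z):=z^m+z^{m-1}q_1q_0^{-1}+\dots+zq_{m-1}q_0^{-1}+q_0^{-1}$. The conjugate polynomials are $\tilde p_l(z):=\overline{p_r(\overline z)}=z^m+\sum_{j=0}^{m-1}\overline{q_j}z^j$, $\tilde p_r(z):=\overline{p_l(\overline z)}=z^m+\sum_{j=0}^{m-1}z^j\overline{q_j}$, $\tilde q_l(z):=\overline{q_r(\overline z)}$ (left coefficients) and $\tilde q_r(z):=\overline{q_l(\overline z)}$ (right coefficients). *)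

(* Defs.v *)
From HB Require Import structures.
From mathcomp Require Import all_boot all_order all_algebra.
From mathcomp Require Import ring lra.
From mathcomp Require Import reals exp.
Set Implicit Arguments.
Unset Strict Implicit.
Unset Printing Implicit Defensive.
Import Order.TTheory GRing.Theory Num.Theory.
Local Open Scope ring_scope.

(* [Quat a b c d] is a + b i + c j + d k. *)
Record quat (R : realType) := Quat { qre : R; qi : R; qj : R; qk : R }.

Section Quaternions.
Variable R : realType.
Local Notation H := (quat R).
Implicit Types x y z : H.

Definition quat_tuple x := (qre x, qi x, qj x, qk x).
Definition tuple_quat (u : R * R * R * R) : H :=
  let: (a, b, c, d) := u in Quat a b c d.
Lemma quat_tupleK : cancel quat_tuple tuple_quat. Proof. by case. Qed.
HB.instance Definition _ := Choice.copy H (can_type quat_tupleK).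

Lemma quatP x y : qre x = qre y -> qi x = qi y -> qj x = qj y -> qk x = qk y ->
  x = y.
Proof. by case: x y => [? ? ? ?] [? ? ? ?] /= -> -> -> ->. Qed.

Definition qadd x y :=
  Quat (qre x + qre y) (qi x + qi y) (qj x + qj y) (qk x + qk y).
Definition qopp x := Quat (- qre x) (- qi x) (- qj x) (- qk x).

Lemma qaddA : associative qadd.
Proof. by move=> x y z; apply: quatP; rewrite /= addrA. Qed.
Lemma qaddC : commutative qadd.
Proof. by move=> x y; apply: quatP; rewrite /= addrC. Qed.
Lemma qadd0 : left_id (Quat 0 0 0 0) qadd.
Proof. by move=> x; apply: quatP; rewrite /= add0r. Qed.
Lemma qaddN : left_inverse (Quat 0 0 0 0) qopp qadd.
Proof. by move=> x; apply: quatP; rewrite /= addNr. Qed.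
HB.instance Definition _ := GRing.isZmodule.Build H qaddA qaddC qadd0 qaddN.

Definition qmul x y := Quat
  (qre x * qre y - qi x * qi y - qj x * qj y - qk x * qk y)
  (qre x * qi y + qi x * qre y + qj x * qk y - qk x * qj y)
  (qre x * qj y - qi x * qk y + qj x * qre y + qk x * qi y)
  (qre x * qk y + qi x * qj y - qj x * qi y + qk x * qre y).

Lemma qmulA : associative qmul.
Proof. by move=> x y z; apply: quatP => /=; ring. Qed.
Lemma qmul1l : left_id (Quat 1 0 0 0) qmul.
Proof. by move=> x; apply: quatP => /=; ring. Qed.
Lemma qmul1r : right_id (Quat 1 0 0 0) qmul.
Proof. by move=> x; apply: quatP => /=; ring. Qed.
Lemma qmulDl : left_distributive qmul +%R.
Proof. by move=> x y z; apply: quatP => /=; ring. Qed.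
Lemma qmulDr : right_distributive qmul +%R.
Proof. by move=> x y z; apply: quatP => /=; ring. Qed.
Lemma qone_neq0 : Quat 1 0 0 0 != 0 :> H.
Proof. by apply/eqP => -[] /eqP; rewrite oner_eq0. Qed.
HB.instance Definition _ := GRing.Zmodule_isNzRing.Build H
  qmulA qmul1l qmul1r qmulDl qmulDr qone_neq0.

Definition qconj x := Quat (qre x) (- qi x) (- qj x) (- qk x).
Definition qsqnorm x := qre x ^+ 2 + qi x ^+ 2 + qj x ^+ 2 + qk x ^+ 2.
Definition qnorm x : R := Num.sqrt (qsqnorm x).

(* The value at 0 is 0. *)
Definition qinv x := Quat (qre x / qsqnorm x) (- qi x / qsqnorm x)
  (- qj x / qsqnorm x) (- qk x / qsqnorm x).

Lemma qsqnorm_eq0 x : (qsqnorm x == 0) = (x == 0).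
Proof.
apply/eqP/eqP => [|->]; last by rewrite /qsqnorm /= !expr0n /= !addr0.
case: x => a b c d; rewrite /qsqnorm /= => /eqP.
rewrite !paddr_eq0 ?addr_ge0 ?sqr_ge0 // !sqrf_eq0.
by move=> /andP[/andP[/andP[/eqP-> /eqP->] /eqP->] /eqP->].
Qed.

Definition qunit : {pred H} := fun x => x != 0.

Lemma qmulVx : {in qunit, left_inverse 1 qinv *%R}.
Proof.
move=> x; rewrite unfold_in -qsqnorm_eq0 /qsqnorm => x0.
by apply: quatP; rewrite /= /qsqnorm; field.
Qed.
Lemma qmulxV : {in qunit, right_inverse 1 qinv *%R}.
Proof.
move=> x; rewrite unfold_in -qsqnorm_eq0 /qsqnorm => x0.
by apply: quatP; rewrite /= /qsqnorm; field.
Qed.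
Lemma qunitP x y : y * x = 1 /\ x * y = 1 -> qunit x.
Proof.
move=> [+ _]; rewrite /qunit; apply: contra_eq_neq => ->.
by rewrite mulr0 eq_sym oner_neq0.
Qed.
Lemma qinv_out : {in [predC qunit], qinv =1 id}.
Proof.
move=> x; rewrite inE unfold_in negbK => /eqP ->.
by apply: quatP; rewrite /= ?oppr0 mul0r.
Qed.
HB.instance Definition _ :=
  GRing.NzRing_hasMulInverse.Build H qmulVx qmulxV qunitP qinv_out.

Lemma qunitE x : (x \is a GRing.unit) = (x != 0). Proof. by []. Qed.

Lemma qconj_is_additive : zmod_morphism qconj.
Proof. by move=> x y; apply: quatP => /=; ring. Qed.
HB.instance Definition _ := GRing.isZmodMorphism.Build H H qconj qconj_is_additive.

Lemma qconjK : involutive qconj.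
Proof. by move=> x; apply: quatP; rewrite /= ?opprK. Qed.
Lemma qconjM x y : qconj (x * y) = qconj y * qconj x.
Proof. by apply: quatP => /=; ring. Qed.
Lemma qconj1 : qconj 1 = 1.
Proof. by apply: quatP; rewrite /= ?oppr0. Qed.
Lemma qconjX x n : qconj (x ^+ n) = qconj x ^+ n.
Proof. by elim: n => [|n IH]; rewrite ?qconj1 // exprS qconjM IH exprSr. Qed.

(* In [{poly H}] the indeterminate is central, so an element only records its
   coefficients. Read with left coefficients, its value at z is the library's
   [p.[z]], the sum of the p`_i * z ^+ i; read with right coefficients, its
   value is [rhorner p z]. *)
Definition rhorner (p : {poly H}) z : H := \sum_(i < size p) z ^+ i * p`_i.

Definition conj_poly (p : {poly H}) : {poly H} := map_poly qconj p.

Lemma coef_conj_poly p i : (conj_poly p)`_i = qconj p`_i.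
Proof. exact: coef_map. Qed.

Lemma size_conj_poly p : size (conj_poly p) = size p.
Proof.
have sz r : (size (conj_poly r) <= size r)%N by apply: size_poly.
have K : conj_poly (conj_poly p) = p.
  by apply/polyP => i; rewrite !coef_conj_poly qconjK.
by apply/eqP; rewrite eqn_leq sz -{1}K sz.
Qed.

Lemma horner_conj_poly p z : (conj_poly p).[z] = qconj (rhorner p (qconj z)).
Proof.
rewrite horner_coef size_conj_poly raddf_sum; apply: eq_bigr => i _ /=.
by rewrite coef_conj_poly qconjM qconjX qconjK.
Qed.

Lemma rhorner_conj_poly p z : rhorner (conj_poly p) z = qconj p.[qconj z].
Proof.
rewrite /rhorner horner_coef size_conj_poly raddf_sum; apply: eq_bigr => i _ /=.
by rewrite coef_conj_poly qconjM qconjX qconjK.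
Qed.

Lemma rhorner_coef_wide n (p : {poly H}) z :
  (size p <= n)%N -> rhorner p z = \sum_(i < n) z ^+ i * p`_i.
Proof.
move=> le_p_n; rewrite /rhorner (big_ord_widen n (fun i => z ^+ i * p`_i)) //.
rewrite big_mkcond; apply: eq_bigr => i _.
by case: ltnP => // /(nth_default 0) ->; rewrite mulr0.
Qed.

Section Polynomials.
Variables (m : nat) (q : m.-tuple H).

Definition poly_l : {poly H} := 'X^m + \sum_(j < m) (q`_j)%:P * 'X^j.
Definition poly_r : {poly H} := 'X^m + \sum_(j < m) 'X^j * (q`_j)%:P.

Definition rev_l : {poly H} :=
  'X^m + \sum_(1 <= j < m) ((q`_0)^-1 * q`_j)%:P * 'X^(m - j) + ((q`_0)^-1)%:P.
Definition rev_r : {poly H} :=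
  'X^m + \sum_(1 <= j < m) 'X^(m - j) * (q`_j * (q`_0)^-1)%:P + ((q`_0)^-1)%:P.

Lemma coef_poly_r i :
  poly_r`_i = (i == m)%:R + (if (i < m)%N then q`_i else 0).
Proof.
rewrite coefD coefXn coef_sum; congr (_ + _).
under eq_bigr => j _ do rewrite coefMC coefXn.
case: ltnP => [lt_im|le_mi].
  rewrite (bigD1 (Ordinal lt_im)) //= eqxx mul1r big1 ?addr0 // => j.
  by rewrite -val_eqE /= eq_sym => /negbTE->; rewrite mul0r.
by rewrite big1 // => j _; rewrite gtn_eqF ?mul0r // (leq_trans (ltn_ord j)).
Qed.

Lemma poly_rE : poly_r = poly_l.
Proof.
congr (_ + _); apply: eq_bigr => j _; apply/polyP => i.
by rewrite coefMC coefCM coefXn; case: eqP;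
  rewrite ?mulr1 ?mulr0 ?mul1r ?mul0r.
Qed.

Lemma size_poly_l : size poly_l = m.+1.
Proof.
rewrite size_polyDl ?size_polyXn // ltnS; apply: (leq_trans (size_sum _ _ _)).
apply/bigmax_leqP => j _; rewrite mul_polyC.
by rewrite (leq_trans (size_scale_leq _ _)) // size_polyXn ltn_ord.
Qed.

Lemma size_rev_l : (0 < m)%N -> size rev_l = m.+1.
Proof.
move=> m_gt0; rewrite /rev_l -addrA size_polyDl ?size_polyXn // ltnS.
apply: (leq_trans (size_polyD _ _)); rewrite geq_max; apply/andP; split.
  rewrite big_seq_cond; apply: (leq_trans (size_sum _ _ _)).
  rewrite -big_seq_cond big_nat; apply/bigmax_leqP_seq => j _ /andP[j_gt0 j_lt].
  rewrite mul_polyC (leq_trans (size_scale_leq _ _)) // size_polyXn.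
  by rewrite -subSn ?(ltnW j_lt) // leq_subLR -add1n leq_add2r.
by rewrite (leq_trans (size_polyC_leq1 _)).
Qed.

Lemma rev_rE : rev_r =
  'X^m + \sum_(1 <= j < m) (q`_j * (q`_0)^-1)%:P * 'X^(m - j) + ((q`_0)^-1)%:P.
Proof.
congr (_ + _ + _); apply: eq_bigr => j _; apply/polyP => i.
by rewrite coefMC coefCM coefXn; case: eqP; rewrite ?mulr1 ?mulr0 ?mul1r ?mul0r.
Qed.

Lemma size_rev_r : (0 < m)%N -> size rev_r = m.+1.
Proof.
move=> m_gt0; rewrite rev_rE -addrA size_polyDl ?size_polyXn // ltnS.
apply: (leq_trans (size_polyD _ _)); rewrite geq_max; apply/andP; split.
  rewrite big_seq_cond; apply: (leq_trans (size_sum _ _ _)).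
  rewrite -big_seq_cond big_nat; apply/bigmax_leqP_seq => j _ /andP[j_gt0 j_lt].
  rewrite mul_polyC (leq_trans (size_scale_leq _ _)) // size_polyXn.
  by rewrite -subSn ?(ltnW j_lt) // leq_subLR -add1n leq_add2r.
by rewrite (leq_trans (size_polyC_leq1 _)).
Qed.

Lemma horner_poly_l z : poly_l.[z] = z ^+ m + \sum_(j < m) q`_j * z ^+ j.
Proof.
rewrite hornerD hornerXn horner_sum; congr (_ + _).
by apply: eq_bigr => j _; rewrite mul_polyC hornerZ hornerXn.
Qed.

Lemma rhorner_poly_r z :
  rhorner poly_r z = z ^+ m + \sum_(j < m) z ^+ j * q`_j.
Proof.
rewrite /rhorner poly_rE size_poly_l -poly_rE big_ord_recr /=.
rewrite coef_poly_r eqxx ltnn addr0 mulr1 addrC; congr (_ + _).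
by apply: eq_bigr => j _; rewrite coef_poly_r ltn_ord ltn_eqF ?ltn_ord // add0r.
Qed.

End Polynomials.

(* The dimension is the degree of the polynomial. *)
Definition companion_l (p : {poly H}) : 'M[H]_((size p).-1) := companionmx p.
Definition companion_r (p : {poly H}) : 'M[H]_((size p).-1) := (companionmx p)^T.

Definition row_sum d (A : 'M[H]_d) (i : 'I_d) : R := \sum_(j < d) qnorm (A i j).
Definition col_sum d (A : 'M[H]_d) (i : 'I_d) : R := \sum_(j < d) qnorm (A j i).

(* [`^] is real exponentiation, with a `^ 0 = 1 for all a, including a = 0.
   The terms being nonnegative, starting the maximum at 0 is harmless. *)
Definition ostrowski_bound (t : nat) (gamma : R) d (M : 'M[H]_d) : R :=
  \big[Num.max/0]_(i < d) (row_sum (M ^+ t) i `^ (gamma / t%:R) *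
                           col_sum (M ^+ t) i `^ ((1 - gamma) / t%:R)).

End Quaternions.

(* Main.v *)
Require Import Defs.
From mathcomp Require Import all_boot all_order all_algebra.
From mathcomp Require Import ring lra zify.
From mathcomp Require Import reals exp.
Import Order.TTheory GRing.Theory Num.Theory.
Local Open Scope ring_scope.

(** Write C for the companion matrix of a monic polynomial p of degree m with
left coefficients. If p(z) = 0, the column (1, z, ..., z^(m-1)) is a right
eigenvector of C for z: C v = v z, since each row of ones shifts the powers of z
and the last row says p(z) = 0 ([companion_l_mul_powers]). Hence C^t v = v z^t.
For right coefficients the row of powers of z is in the same way a left
eigenvector of the transposed companion matrix ([powers_mul_companion_r]).

The Ostrowski bound |lambda| <= max_i r_i^g c_i^(1-g) survives over the
quaternions for such one-sided eigenvalues. The modulus is multiplicative and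
subadditive, so A v = v lambda gives |lambda| |v_i| <= sum_j |a_ij| |v_j|, an
inequality about nonnegative reals only, and it implies the bound
([ostrowski_nonneg]). A left eigenvector gives the same inequality for the
transposed moduli, where rows and columns, hence g and 1 - g, change places.
With A = C^t and lambda = z^t, a t-th root gives the upper bounds.

If p has a nonzero constant term, z is nonzero, and its inverse is a zero of the
reversal polynomial ([horner_rev_l]); the upper bound for that zero is the lower
bound for |z|. Conjugation reverses products, so it exchanges left and right
coefficients and sends zeros to conjugates of zeros, of the same modulus. This
gives the bounds from the conjugate polynomials, and it also turns the claim for
right coefficients q_j into the one for left coefficients, applied to the
conjugates of the q_j. *)

(** * The quaternion modulus *)

Section Modulus.
Variable R : realType.
Implicit Types x y : quat R.

Lemma qnorm_ge0 x : 0 <= qnorm x.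
Proof. exact: sqrtr_ge0. Qed.

Lemma qsqnorm_ge0 x : 0 <= qsqnorm x.
Proof. by rewrite !addr_ge0 ?sqr_ge0. Qed.

Lemma qnorm_gt0 x : (0 < qnorm x) = (x != 0).
Proof. by rewrite sqrtr_gt0 lt0r qsqnorm_ge0 andbT qsqnorm_eq0. Qed.

Lemma qnorm0 : qnorm (0 : quat R) = 0.
Proof. by apply/eqP; rewrite eq_le qnorm_ge0 leNgt qnorm_gt0 eqxx. Qed.

Lemma qnorm1 : qnorm (1 : quat R) = 1.
Proof. by rewrite /qnorm /qsqnorm /= expr1n expr0n !addr0 sqrtr1. Qed.

Lemma qnormM x y : qnorm (x * y) = qnorm x * qnorm y.
Proof.
rewrite /qnorm -sqrtrM ?qsqnorm_ge0 //; congr Num.sqrt.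
by case: x y => [a b c d] [a' b' c' d']; rewrite /qsqnorm /=; ring.
Qed.

Lemma qnormX x n : qnorm (x ^+ n) = qnorm x ^+ n.
Proof. by elim: n => [|n IH]; rewrite ?qnorm1 // !exprS qnormM IH. Qed.

Lemma qnorm_conj x : qnorm (qconj x) = qnorm x.
Proof. by rewrite /qnorm /qsqnorm /= !sqrrN. Qed.

Lemma qnormV x : qnorm x^-1 = (qnorm x)^-1.
Proof.
have [->|x0] := eqVneq x 0; first by rewrite invr0 qnorm0 invr0.
apply: (@mulfI _ (qnorm x)); first by rewrite gt_eqF // qnorm_gt0.
by rewrite -qnormM !divrr ?qnorm1 // unitfE gt_eqF // qnorm_gt0.
Qed.

Lemma qconjV x : qconj x^-1 = (qconj x)^-1.
Proof. by apply: quatP; rewrite /= /qsqnorm /= !sqrrN ?mulNr. Qed.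

Lemma qre_le_qnorm x : qre x <= qnorm x.
Proof.
rewrite (le_trans (ler_norm _)) // -sqrtr_sqr ler_sqrt ?qsqnorm_ge0 //.
by rewrite /qsqnorm -!addrA lerDl !addr_ge0 ?sqr_ge0.
Qed.

(** The cross term of |x + y|^2 is twice the real part of x times the conjugate
of y, so Cauchy-Schwarz reduces to [qre_le_qnorm] and multiplicativity. *)
Lemma qnormD x y : qnorm (x + y) <= qnorm x + qnorm y.
Proof.
rewrite -(@ler_pXn2r _ 2) ?nnegrE ?addr_ge0 ?qnorm_ge0 //.
have := qre_le_qnorm (x * qconj y).
rewrite qnormM qnorm_conj sqrrD !sqr_sqrtr ?qsqnorm_ge0 //.
suff -> : qsqnorm (x + y) =
    qsqnorm x + qsqnorm y + qre (x * qconj y) *+ 2 by lra.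
by rewrite /qsqnorm /=; ring.
Qed.

Lemma qnorm_sum (I : Type) (r : seq I) (F : I -> quat R) :
  qnorm (\sum_(i <- r) F i) <= \sum_(i <- r) qnorm (F i).
Proof.
elim/big_rec2: _ => [|i s x _ IH]; first by rewrite qnorm0.
by rewrite (le_trans (qnormD _ _)) // lerD2l.
Qed.

End Modulus.

(** * The Ostrowski inequality for nonnegative matrices *)

Section NonnegativeOstrowski.
Variables (R : realType) (d : nat).
Implicit Types (b : 'I_d -> 'I_d -> R) (w x y : 'I_d -> R) (g mu : R).

(** Young's inequality with one factor equal to 1, that is, u^p lies above its
tangent at u = 1, where p = 1 / (1 - g). Rescaling u freely gives back the
strength of Hoelder's inequality. *)
Lemma tangent_powR g (u : R) : 0 <= g < 1 -> 0 <= u ->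
  u <= g + (1 - g) * u `^ (1 - g)^-1.
Proof.
move=> /andP[g0 g1] u0; have [<-|gn0] := eqVneq 0 g.
  by rewrite subr0 add0r mul1r invr1 powRr1.
have gp : 0 < g by rewrite lt0r eq_sym gn0.
have := @conjugate_powR _ u 1 (1 - g)^-1 g^-1 u0 ler01.
rewrite mulr1 powR1 !invr_gt0 !invrK subrK mul1r.
by rewrite [u `^ _ * _]mulrC [_ * _ + g]addrC; apply=> //; rewrite subr_gt0.
Qed.

Lemma weighted_sum_le x y w i0 :
  (forall i, 0 <= w i) -> 0 < w i0 ->
  \sum_i x i * w i <= \sum_i y i * w i ->
  exists2 i, 0 < w i & x i <= y i.
Proof.
move=> w0 wi0 le_xy; apply/exists_inP; apply: contraLR le_xy.
rewrite negb_exists_in -ltNge => /forall_inP xy.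
have xy' i : y i * w i <= x i * w i.
  have := w0 i; rewrite le0r => /orP[/eqP->|/xy]; first by rewrite !mulr0.
  by rewrite -ltNge => /ltW/ler_wpM2r; apply.
rewrite (bigD1 i0) //= [ltRHS](bigD1 i0) //= ltr_leD ?ler_sum //.
by rewrite ltr_pM2r // ltNge xy.
Qed.

(** For g < 1 put p = 1 / (1 - g), r_i and c_i for the row and column sums.
Hoelder's inequality applied to the hypothesis reads
r_i (mu / r_i)^p w_i^p <= sum_j b_ij w_j^p. Summing over i, the right-hand side
becomes sum_j c_j w_j^p, so some i with w_i > 0 has r_i (mu / r_i)^p <= c_i;
the power 1 - g of this is the claim. For g = 1 an index maximizing w works. *)
Lemma ostrowski_nonneg b w mu g i0 :
  0 <= g <= 1 -> (forall i j, 0 <= b i j) ->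
  (forall i, 0 <= w i) -> 0 < w i0 -> 0 <= mu ->
  (forall i, mu * w i <= \sum_j b i j * w j) ->
  exists i, mu <= (\sum_j b i j) `^ g * (\sum_j b j i) `^ (1 - g).
Proof.
move=> /andP[g0 g1] b0 w0 wi0 mu0 Hb.
have [<-|mun0] := eqVneq 0 mu; first by exists i0; rewrite mulr_ge0 ?powR_ge0.
have mup : 0 < mu by rewrite lt0r eq_sym mun0.
have r0 i : 0 <= \sum_j b i j by rewrite sumr_ge0.
have c0 i : 0 <= \sum_j b j i by rewrite sumr_ge0.
have [->|gn1] := eqVneq g 1.
  have [i max_wi] : exists i, forall j, w j <= w i.
    case: (@arg_maxP _ _ _ i0 xpredT w isT) => i _ le_wi.
    by exists i => j; apply: le_wi.
  exists i; rewrite subrr powRr0 mulr1 powRr1 //.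
  have wi : 0 < w i by rewrite (lt_le_trans wi0) // max_wi.
  rewrite -(ler_pM2r wi) (le_trans (Hb i)) // mulr_suml ler_sum // => j _.
  by rewrite ler_wpM2l ?max_wi.
have gl1 : 0 < 1 - g by rewrite subr_gt0 lt_neqAle gn1.
set p := (1 - g)^-1.
have r_gt0 i : 0 < w i -> 0 < \sum_j b i j.
  move=> wi; rewrite lt0r r0 andbT psumr_eq0 //; apply: contraTN (Hb i).
  move=> /allP bi0; rewrite -ltNge big1 ?mulr_gt0 // => j _.
  by rewrite (eqP (bi0 j (mem_index_enum j))) mul0r.
have p0 : p != 0 by rewrite invr_eq0 gt_eqF.
have Hi i : (\sum_j b i j) * (mu / \sum_j b i j) `^ p * w i `^ p <=
            \sum_j b i j * w j `^ p.
  have := w0 i; rewrite le0r => /orP[/eqP->|wi].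
    by rewrite powR0 // mulr0 sumr_ge0 // => j _; rewrite mulr_ge0 ?powR_ge0.
  have rp := r_gt0 i wi; set r := \sum_j b i j in rp *.
  (* The scale e of the w j makes the linear term g * (e * r) of the tangent
     bound exactly the fraction g of mu * w i, so that it can be absorbed. *)
  set e := mu * w i / r; have ep : 0 < e by rewrite divr_gt0 ?mulr_gt0.
  have -> : r * (mu / r) `^ p * w i `^ p = r * e `^ p.
    rewrite -mulrA -powRM ?w0 ?divr_ge0 // ?ltW //.
    by rewrite /e mulrAC.
  set S := \sum_j _.
  have le_w : \sum_j b i j * w j <= g * (e * r) + (1 - g) * (e / e `^ p * S).
    rewrite /r /S !mulr_sumr -big_split ler_sum //= => j _.
    have -> : g * (e * b i j) + (1 - g) * (e / e `^ p * (b i j * w j `^ p)) =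
              b i j * (e * (g + (1 - g) * (w j / e) `^ p)).
      have -> : (w j / e) `^ p = w j `^ p / e `^ p; last by ring.
      by rewrite powRM ?invr_ge0 ?(ltW ep) // -(powR_inv1 (ltW ep)) -powRrM
                 mulN1r powRN.
    rewrite ler_wpM2l // mulrC -ler_pdivrMr // tangent_powR ?g0 ?divr_ge0 //.
    - by rewrite -subr_gt0.
    - by rewrite mulr_ge0 ?w0.
    - exact: r0.
  have er : e * r = mu * w i by rewrite /e divfK ?gt_eqF.
  have le_er : e * r <= e / e `^ p * S.
    rewrite -(ler_pM2l gl1) mulrBl mul1r lerBlDl {1}er.
    exact: le_trans (Hb i) le_w.
  by move: le_er; rewrite -mulrA ler_pM2l // mulrC ler_pdivlMr ?powR_gt0 //.
have [i] : exists2 i, 0 < w i `^ p &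
    (\sum_j b i j) * (mu / \sum_j b i j) `^ p <= \sum_j b j i.
  apply: (@weighted_sum_le _ _ _ i0) => [i||]; rewrite ?powR_ge0 ?powR_gt0 //.
  apply: (le_trans (ler_sum _ (fun i _ => Hi i))).
  by rewrite exchange_big /=; apply: ler_sum => j _; rewrite mulr_suml.
move=> wpi le_c; exists i.
have wi : 0 < w i by apply: gt0_powR wpi; rewrite ?invr_gt0.
have rp := r_gt0 i wi; set r := \sum_j b i j in rp le_c *.
set c := \sum_j b j i in le_c *.
have mur : 0 <= mu / r by rewrite divr_ge0 ?ltW.
have : ((mu / r) `^ p) `^ (1 - g) <= (c / r) `^ (1 - g).
  rewrite ge0_ler_powR ?nnegrE ?powR_ge0 ?(divr_ge0 (c0 i)) ?(ltW rp)
    ?(ltW gl1) //.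
  by rewrite ler_pdivlMr // mulrC.
rewrite -powRrM mulVf ?gt_eqF // powRr1 // ler_pdivrMr //.
rewrite powRM ?invr_ge0 ?(c0 i) ?(ltW rp) //.
rewrite -mulrA mulrC; congr (_ <= _ * _).
rewrite -[in LHS](powR_inv1 (ltW rp)) -powRrM mulN1r opprB.
rewrite powRB ?(gt_eqF rp) ?implybT //.
by rewrite powRr1 ?divfK ?gt_eqF // ltW.
Qed.

End NonnegativeOstrowski.

(** * One-sided eigenvalues of quaternion matrices *)

Section RightAndLeftEigenvalues.
Variables (R : realType) (d : nat).
Implicit Types (A : 'M[quat R]_d) (z : quat R) (g : R).

(** The eigenvalue multiplies the column from the right, which over a
noncommutative ring differs from the scalar multiple z v; writing it as a 1 x 1
matrix lets associativity of the product carry the induction. *)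
Lemma mul_expmx_scalar A (v : 'cV_d) z t :
  A *m v = v *m z%:M -> A ^+ t *m v = v *m (z ^+ t)%:M.
Proof.
move=> Av; elim: t => [|t IH]; first by rewrite !expr0 mulmx1 mul1mx.
by rewrite exprSr -mulmxE -mulmxA Av mulmxA IH -mulmxA -scalar_mxM exprSr.
Qed.

Lemma mul_scalar_expmx A (u : 'rV_d) z t :
  u *m A = z%:M *m u -> u *m A ^+ t = (z ^+ t)%:M *m u.
Proof.
move=> uA; elim: t => [|t IH]; first by rewrite !expr0 mulmx1 mul1mx.
by rewrite exprS -mulmxE mulmxA uA -mulmxA IH mulmxA -scalar_mxM exprS.
Qed.

Lemma ostrowski_right A (v : 'cV_d) z g i0 :
  0 <= g <= 1 -> v i0 0 != 0 -> A *m v = v *m z%:M ->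
  exists i, qnorm z <= row_sum A i `^ g * col_sum A i `^ (1 - g).
Proof.
move=> g01 v0 /matrixP Av.
apply: (@ostrowski_nonneg R d (fun i j => qnorm (A i j))
          (fun i => qnorm (v i 0)) _ _ i0) => // [i j|i|||i];
  rewrite ?qnorm_ge0 ?qnorm_gt0 //.
move: (Av i 0); rewrite !mxE big_ord1 !mxE eqxx mulr1n mulrC -qnormM => <-.
apply: le_trans (qnorm_sum _ _ _ _) _.
by apply: ler_sum => j _; rewrite qnormM.
Qed.

(** The real inequality is applied to the transpose with exponent 1 - g. *)
Lemma ostrowski_left A (u : 'rV_d) z g i0 :
  0 <= g <= 1 -> u 0 i0 != 0 -> u *m A = z%:M *m u ->
  exists i, qnorm z <= row_sum A i `^ g * col_sum A i `^ (1 - g).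
Proof.
move=> /andP[g0 g1] u0 /matrixP uA.
have [||i|||i|i] := @ostrowski_nonneg R d (fun i j => qnorm (A j i))
          (fun i => qnorm (u 0 i)) (qnorm z) (1 - g) i0;
  rewrite ?subr_ge0 ?lerBlDr ?lerDl ?g0 ?g1 ?qnorm_ge0 ?qnorm_gt0 //.
- by move=> i j; rewrite qnorm_ge0.
- move: (uA 0 i); rewrite !mxE big_ord1 !mxE eqxx mulr1n -qnormM => <-.
  apply: le_trans (qnorm_sum _ _ _ _) _.
  by apply: ler_sum => j _; rewrite qnormM mulrC.
- by rewrite subKr mulrC; exists i.
Qed.

Lemma qnorm_le_ostrowski_bound A z t g :
  (0 < t)%N ->
  (exists i, qnorm (z ^+ t) <=
     row_sum (A ^+ t) i `^ g * col_sum (A ^+ t) i `^ (1 - g)) ->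
  qnorm z <= ostrowski_bound t g A.
Proof.
move=> t0 [i]; rewrite qnormX => le_z; apply: (bigmax_sup i) => //.
have tr0 : t%:R != 0 :> R by rewrite pnatr_eq0 -lt0n.
have sum0 (F : 'I_d -> quat R) : 0 <= \sum_j qnorm (F j).
  by rewrite sumr_ge0 // => j _; apply: qnorm_ge0.
have -> : qnorm z = (qnorm z ^+ t) `^ t%:R^-1.
  by rewrite -powR_mulrn ?qnorm_ge0 // -powRrM mulfV // powRr1 ?qnorm_ge0.
rewrite !powRrM -powRM ?powR_ge0 //.
by rewrite ge0_ler_powR ?nnegrE ?invr_ge0 ?ler0n ?mulr_ge0 ?powR_ge0
  ?exprn_ge0 ?qnorm_ge0.
Qed.

End RightAndLeftEigenvalues.

(** * Zeros as eigenvalues of companion matrices *)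

Section Companion.
Variable R : realType.
Implicit Types (p : {poly quat R}) (z : quat R).

Lemma companion_l_mul_powers p z :
  p \is monic -> p.[z] = 0 ->
  companion_l p *m (\col_i z ^+ i) = (\col_i z ^+ i) *m z%:M.
Proof.
move=> /monicP lead_p pz; apply/matrixP => i k; rewrite !mxE big_ord1 !mxE ord1.
rewrite mulr1n -exprSr; under eq_bigr do rewrite !mxE.
have [i_last|i_not_last] := eqVneq (i : nat) (size p).-2.
  have le_p : (size p <= (size p).-1.+1)%N by case: (size p).
  have -> : i.+1 = (size p).-1 by case: i i_last => /=; lia.
  move: pz; rewrite (horner_coef_wide _ le_p) big_ord_recr /=.
  rewrite -lead_coefE lead_p mul1r => /eqP; rewrite addrC addr_eq0 => /eqP ->.
  by rewrite -sumrN; apply: eq_bigr => j _; rewrite mulNr.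
have i1_lt : (i.+1 < (size p).-1)%N by case: i i_not_last => i /= lt_i; lia.
rewrite (bigD1 (Ordinal i1_lt)) //= eqxx mul1r big1 ?addr0 // => j.
by rewrite -val_eqE /= eq_sym => /negPf->; rewrite mul0r.
Qed.

Lemma powers_mul_companion_r p z :
  p \is monic -> rhorner p z = 0 ->
  (\row_i z ^+ i) *m companion_r p = z%:M *m (\row_i z ^+ i).
Proof.
move=> /monicP lead_p pz; apply/matrixP => k i; rewrite !mxE big_ord1 !mxE ord1.
rewrite mulr1n -exprS; under eq_bigr do rewrite !mxE.
have [i_last|i_not_last] := eqVneq (i : nat) (size p).-2.
  have le_p : (size p <= (size p).-1.+1)%N by case: (size p).
  have -> : i.+1 = (size p).-1 by case: i i_last => /=; lia.
  move: pz; rewrite (rhorner_coef_wide _ le_p) big_ord_recr /=.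
  rewrite -lead_coefE lead_p mulr1 => /eqP; rewrite addrC addr_eq0 => /eqP ->.
  by rewrite -sumrN; apply: eq_bigr => j _; rewrite mulrN.
have i1_lt : (i.+1 < (size p).-1)%N by case: i i_not_last => i /= lt_i; lia.
rewrite (bigD1 (Ordinal i1_lt)) //= eqxx mulr1 big1 ?addr0 // => j.
by rewrite -val_eqE /= eq_sym => /negPf->; rewrite mulr0.
Qed.

(** The vector of powers of z is nonzero because its first entry is 1. *)
Lemma left_zero_le p z t g :
  (0 < t)%N -> 0 <= g <= 1 -> p \is monic -> (1 < size p)%N -> p.[z] = 0 ->
  qnorm z <= ostrowski_bound t g (companion_l p).
Proof.
move=> t0 g01 p_monic p_gt1 pz; have d_gt0 : (0 < (size p).-1)%N by lia.
apply: qnorm_le_ostrowski_bound => //.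
apply: (@ostrowski_right _ _ _ (\col_i z ^+ i) _ _ (Ordinal d_gt0)) => //.
  by rewrite mxE oner_eq0.
by apply: mul_expmx_scalar; apply: companion_l_mul_powers.
Qed.

Lemma right_zero_le p z t g :
  (0 < t)%N -> 0 <= g <= 1 -> p \is monic -> (1 < size p)%N ->
  rhorner p z = 0 -> qnorm z <= ostrowski_bound t g (companion_r p).
Proof.
move=> t0 g01 p_monic p_gt1 pz; have d_gt0 : (0 < (size p).-1)%N by lia.
apply: qnorm_le_ostrowski_bound => //.
apply: (@ostrowski_left _ _ _ (\row_i z ^+ i) _ _ (Ordinal d_gt0)) => //.
  by rewrite mxE oner_eq0.
by apply: mul_scalar_expmx; apply: powers_mul_companion_r.
Qed.

End Companion.

(** * Reversal and conjugation *)

Section Reversal.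
Variables (R : realType) (m : nat).
Implicit Types (q : m.-tuple (quat R)) (p : {poly quat R}) (z : quat R).

Lemma monic_conj_poly p : p \is monic -> conj_poly p \is monic.
Proof.
move=> /monicP p1; apply/monicP.
by rewrite lead_coefE size_conj_poly coef_conj_poly -lead_coefE p1 qconj1.
Qed.

Lemma monic_poly_l q : poly_l q \is monic.
Proof.
apply/monicP; rewrite lead_coefE size_poly_l -poly_rE coef_poly_r.
by rewrite eqxx ltnn addr0.
Qed.

Lemma monic_rev_l q : (0 < m)%N -> rev_l q \is monic.
Proof.
move=> m_gt0; apply/monicP; rewrite lead_coefE size_rev_l //=.
rewrite !coefD coefXn eqxx coefC gtn_eqF // addr0 coef_sum big_nat.
rewrite big1 ?addr0 // => j j_range.
by rewrite coefCM coefXn; case: eqP => [|_]; [lia|rewrite mulr0].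
Qed.

(** Since z commutes with its inverse, z^-(m-j) = z^j z^-m, and z^-m factors out
on the right, away from the left coefficients. *)
Lemma horner_rev_l q z : (0 < m)%N -> q`_0 != 0 -> z != 0 ->
  (rev_l q).[z^-1] = (q`_0)^-1 * (poly_l q).[z] * z^-1 ^+ m.
Proof.
move=> m_gt0 q0 z0; have zU : z \is a GRing.unit by rewrite qunitE.
have zX k : (k <= m)%N -> z ^+ k * z^-1 ^+ m = z^-1 ^+ (m - k).
  move=> le_km; rewrite -{1}(subnKC le_km) exprD mulrA exprVn.
  by rewrite mulrV ?unitrX // mul1r exprVn.
rewrite horner_poly_l -(big_mkord xpredT (fun j => q`_j * z ^+ j)) big_ltn //.
rewrite expr0 mulr1 2!mulrDr 2!mulrDl mulVr ?qunitE // mul1r.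
rewrite -mulrA zX // subnn mulr1 addrC -addrA [RHS]addrCA addrC.
rewrite !hornerD hornerXn hornerC horner_sum mulr_sumr mulr_suml [RHS]addrAC.
congr (_ + _ + _).
rewrite !big_nat; apply: eq_bigr => j /andP[_ /ltnW le_jm].
by rewrite mul_polyC hornerZ hornerXn -!mulrA zX.
Qed.

Definition conj_tuple q : m.-tuple (quat R) := map_tuple (@qconj R) q.

Lemma nth_conj_tuple q j : (conj_tuple q)`_j = qconj q`_j.
Proof.
have [lt_jm|le_mj] := ltnP j m; first by rewrite (nth_map 0) ?size_tuple.
by rewrite !nth_default ?raddf0 ?size_tuple.
Qed.

Lemma conj_polyMXn c n :
  conj_poly (c%:P * 'X^n) = (qconj c)%:P * 'X^n :> {poly quat R}.
Proof.
have coefE a i : (a%:P * 'X^n : {poly quat R})`_i = a * (i == n)%:R.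
  by rewrite coefCM coefXn.
apply/polyP => i; apply: etrans (coef_conj_poly _ _) _.
apply: etrans (congr1 (@qconj R) (coefE _ _)) (esym _).
apply: etrans (coefE _ _) _.
by case: eqP => _; rewrite ?mulr1 // !mulr0 raddf0.
Qed.

Lemma conj_polyXn n : conj_poly 'X^n = 'X^n :> {poly quat R}.
Proof. by rewrite -['X^n]mul1r -polyC1 conj_polyMXn qconj1. Qed.

Lemma conj_poly_r q : conj_poly (poly_r q) = poly_l (conj_tuple q).
Proof.
rewrite poly_rE /poly_l /conj_poly raddfD raddf_sum /=.
congr (_ + _); first exact: conj_polyXn.
by apply: eq_bigr => j _; rewrite nth_conj_tuple; apply: conj_polyMXn.
Qed.

Lemma conj_rev_r q : conj_poly (rev_r q) = rev_l (conj_tuple q).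
Proof.
rewrite rev_rE /rev_l /conj_poly !raddfD raddf_sum /= map_polyC /=.
rewrite nth_conj_tuple qconjV; congr (_ + _ + _); first exact: conj_polyXn.
apply: eq_bigr => j _; rewrite nth_conj_tuple -qconjV -qconjM.
exact: conj_polyMXn.
Qed.

Lemma conj_polyK : involutive (@conj_poly R).
Proof. by move=> p; apply/polyP => i; rewrite !coef_conj_poly qconjK. Qed.

(** The second pair of bounds is the first one seen through conjugation: the
conjugate of z is a zero, with right coefficients, of the conjugate of p. *)
Lemma left_zero_bounds q t g z :
  (0 < m)%N -> q`_0 != 0 -> (0 < t)%N -> 0 <= g <= 1 -> (poly_l q).[z] = 0 ->
  ((ostrowski_bound t g (companion_l (rev_l q)))^-1 <= qnorm z <=
     ostrowski_bound t g (companion_l (poly_l q))) /\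
  ((ostrowski_bound t g (companion_r (conj_poly (rev_l q))))^-1 <= qnorm z <=
     ostrowski_bound t g (companion_r (conj_poly (poly_l q)))).
Proof.
move=> m_gt0 q0 t_gt0 g01 pz.
have z0 : z != 0.
  apply: contraNneq q0 => z0; move: pz; rewrite z0 horner_coef0 -poly_rE.
  by rewrite coef_poly_r m_gt0 eq_sym gtn_eqF // add0r => ->.
have rz : (rev_l q).[z^-1] = 0 by rewrite horner_rev_l // pz mulr0 mul0r.
have inv_le b : qnorm z^-1 <= b -> b^-1 <= qnorm z.
  rewrite qnormV => le_b; rewrite -[leRHS]invrK.
  rewrite lef_pV2 ?posrE ?invr_gt0 ?qnorm_gt0 //.
  by rewrite (lt_le_trans _ le_b) // invr_gt0 qnorm_gt0.
have conj_zero p x : p.[x] = 0 -> rhorner (conj_poly p) (qconj x) = 0.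
  by move=> px; rewrite rhorner_conj_poly qconjK px raddf0.
split; apply/andP; split.
- by apply/inv_le/left_zero_le; rewrite ?monic_rev_l ?size_rev_l.
- by apply: left_zero_le; rewrite ?monic_poly_l ?size_poly_l.
- rewrite inv_le // -qnorm_conj; apply: right_zero_le; rewrite ?conj_zero //.
    by rewrite monic_conj_poly ?monic_rev_l.
  by rewrite size_conj_poly size_rev_l.
- rewrite -qnorm_conj; apply: right_zero_le; rewrite ?conj_zero //.
    by rewrite monic_conj_poly ?monic_poly_l.
  by rewrite size_conj_poly size_poly_l.
Qed.

End Reversal.

Theorem theorem5p6 (R : realType) (m : nat) (q : m.-tuple (quat R))
    (t : nat) (gamma : R) :
  (0 < m)%N -> q`_0 != 0 -> (2 <= t)%N -> 0 <= gamma <= 1 ->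
  let p_l := poly_l q in
  let p_r := poly_r q in
  let q_l := rev_l q in
  let q_r := rev_r q in
  let tp_l := conj_poly p_r in
  let tp_r := conj_poly p_l in
  let tq_l := conj_poly q_r in
  let tq_r := conj_poly q_l in
  let C_l := @companion_l R in
  let C_r := @companion_r R in
  let N := @ostrowski_bound R t gamma in
  (forall z : quat R, p_l.[z] = 0 ->
     (N _ (C_l q_l))^-1 <= qnorm z <= N _ (C_l p_l) /\
     (N _ (C_r tq_r))^-1 <= qnorm z <= N _ (C_r tp_r)) /\
  (forall z : quat R, rhorner p_r z = 0 ->
     (N _ (C_r q_r))^-1 <= qnorm z <= N _ (C_r p_r) /\
     (N _ (C_l tq_l))^-1 <= qnorm z <= N _ (C_l tp_l)).
Proof.
move=> m_gt0 q0 /ltnW t_gt0 g01 /=.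
split=> z pz; first exact: left_zero_bounds.
(* The claim is the one for left coefficients, with the conjugate coefficients,
   the conjugate zero and the two pairs of bounds exchanged. *)
have rev_rE' : rev_r q = conj_poly (rev_l (conj_tuple R m q)).
  by rewrite -conj_rev_r conj_polyK.
have poly_rE' : poly_r q = conj_poly (poly_l (conj_tuple R m q)).
  by rewrite -conj_poly_r conj_polyK.
rewrite conj_rev_r conj_poly_r rev_rE' poly_rE' -qnorm_conj and_comm.
apply: left_zero_bounds => //; last first.
  by rewrite -conj_poly_r horner_conj_poly qconjK pz raddf0.
by rewrite nth_conj_tuple -qnorm_gt0 qnorm_conj qnorm_gt0.
Qed.
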